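(* Let $n\ge1$ and let $p=a_nX^n+\dots+a_1X+a_0$ be a polynomial with positive real coefficients satisfying $a_0\ge a_1\ge\dots\ge a_n>0$. Let $Q=\{a_\nu/a_{\nu+1}: 0\le\nu<n\}$ and put $r=\min Q$ and $R=\max Q$ (so $r\le R$). Then, for $z\in\mathbb{C}\setminus\{r,R\}$, the following inequalities hold: (1) if $|z|\le r$, then $$\frac{r-|z|}{|r-z|}\le\frac{|p(z)|}{a_0}\le\frac{r+|z|}{|r-z|};$$ (2) if $|z|\ge R$, then $$\frac{|z|-R}{|z-R|}\le\frac{|p(z)|}{a_n|z|^n}\le\frac{R+|z|}{|R-z|}.$$ *)

(* Defs.v *)
From mathcomp Require Import all_boot all_order all_algebra.
From mathcomp Require Import reals complex.
Set Implicit Arguments.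
Unset Strict Implicit.
Unset Printing Implicit Defensive.
Import Order.TTheory GRing.Theory Num.Theory.
Local Open Scope ring_scope.

Definition coef_ratios (K : realType) (p : {poly K}) : seq K :=
  [seq p`_i / p`_i.+1 | i <- iota 0 (size p).-1].

Definition is_min (K : realType) (Q : seq K) (m : K) : Prop :=
  m \in Q /\ {in Q, forall q, m <= q}.

Definition is_max (K : realType) (Q : seq K) (m : K) : Prop :=
  m \in Q /\ {in Q, forall q, q <= m}.

(* In K[i] the modulus `|z| is itself a complex number (with zero imaginary
   part), and u <= v means 'Im u = 'Im v and 'Re u <= 'Re v; between moduli
   and embedded reals x%:C it is the order of K. *)
Definition complex_poly (K : realType) (p : {poly K}) : {poly K[i]} :=
  map_poly (real_complex K) p.

(* Main.v *)
Require Import Defs.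
From mathcomp Require Import all_boot all_order all_algebra.
From mathcomp Require Import reals complex.
From mathcomp Require Import ring.
Set Implicit Arguments.
Unset Strict Implicit.
Unset Printing Implicit Defensive.
Import Order.TTheory GRing.Theory Num.Theory.
Local Open Scope ring_scope.
Local Open Scope complex_scope.

(** The idea is that of the Enestrom-Kakeya theorem.  Multiplying [p] by a
    suitable linear factor isolates one dominant monomial: since
    [r * a_(i+1) <= a_i <= R * a_(i+1)], both

      [r * a_0 - (r - X) * p
         = \sum_(i <= n) (a_i - r * a_(i+1)) * X^(i+1)] and
      [a_n * X^(n+1) - (X - R) * p
         = R * a_0 + \sum_(i < n) (R * a_(i+1) - a_i) * X^(i+1)],

    where [a_(n+1)] is read as 0, have nonnegative coefficients.  A polynomial
    [q] with nonnegative coefficients satisfies [|q(z)| <= q(|z|)], so the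
    triangle inequality, applied to the difference of the monomial and [q],
    compares the value of [(r - X) * p] (or [(X - R) * p]) at [z] with its value
    at [|z|] ([norm_monomial_sub_bounds]).  The hypothesis on [|z|] makes the
    linear factor nonnegative at [|z|], and [p(|z|)] is bounded below by any one
    of its terms: [a_0] in the first case, [a_n |z|^n] in the second.  Dividing
    by the norm of the linear factor yields the four inequalities.

    The two halves are proved over an arbitrary numeric field, because moduli
    and embedded reals then live in the same ring as [z]; the order may be
    partial, as it is for complex numbers. *)

Lemma norm_horner_le (F : numDomainType) (q : {poly F}) (z : F) :
  (forall i, 0 <= q`_i) -> `|q.[z]| <= q.[`|z|].
Proof.
move=> q_ge0; rewrite !horner_coef; apply: le_trans (ler_norm_sum _ _ _) _.
by apply: ler_sum => i _; rewrite normrM normrX (ger0_norm (q_ge0 i)).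
Qed.

Lemma term_le_horner (F : numDomainType) (p : {poly F}) (x : F) (k : nat) :
  (forall i, 0 <= p`_i) -> 0 <= x -> p`_k * x ^+ k <= p.[x].
Proof.
move=> p_ge0 x_ge0.
have terms_ge0 i : 0 <= p`_i * x ^+ i by rewrite mulr_ge0 ?exprn_ge0.
rewrite horner_coef; have [k_lt|k_ge] := ltnP k (size p).
  by rewrite (bigD1 (Ordinal k_lt)) //= lerDl sumr_ge0.
by rewrite nth_default // mul0r sumr_ge0.
Qed.

(** The upper bound is the lower one reflected at the norm of the monomial:
    by the triangle inequality the norm of the difference deviates from
    [c * |z|^k] by at most [|q(z)| <= q(|z|) <= c * |z|^k - t]. *)
Lemma norm_monomial_sub_bounds (F : numDomainType) (c t z : F) (k : nat)
    (q : {poly F}) :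
    0 <= c -> (forall i, 0 <= q`_i) ->
    t <= (c *: 'X^k - q).[`|z|] ->
  t <= `|(c *: 'X^k - q).[z]| <= c * `|z| ^+ k *+ 2 - t.
Proof.
move=> c_ge0 q_ge0; rewrite !(hornerD, hornerN, hornerZ, hornerXn) => t_le.
have q_le : `|q.[z]| <= c * `|z| ^+ k - t.
  apply: le_trans (norm_horner_le z q_ge0) _.
  by rewrite lerBrDl -lerBrDr.
have norm_monomial : `|c * z ^+ k| = c * `|z| ^+ k.
  by rewrite normrM normrX ger0_norm.
apply/andP; split.
  apply: le_trans (lerB_dist _ _); rewrite norm_monomial.
  by rewrite lerBrDl -lerBrDr.
apply: le_trans (ler_normB _ _) _.
by rewrite norm_monomial mulr2n -addrA lerD2l.
Qed.

(** Near the origin the constant term of [(r - X) * p] dominates.  The lower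
    bound [t] at [|z|] is [(r - |z|) * p`_0], whose reflection
    [2 * r * p`_0 - t] is [(r + |z|) * p`_0]. *)
Lemma bounds_below_coef_ratios (F : numFieldType) (p : {poly F}) (r z : F) :
    0 <= r -> 0 < p`_0 -> (forall i, 0 <= p`_i) ->
    (forall i, r * p`_i.+1 <= p`_i) ->
    z != r -> `|z| <= r ->
  (r - `|z|) / `|r - z| <= `|p.[z]| / p`_0 <= (r + `|z|) / `|r - z|.
Proof.
move=> r_ge0 p0_gt0 p_ge0 ratio_ge z_neq z_le.
pose q := (r * p`_0) *: 'X^0 - (r%:P - 'X) * p.
have q_ge0 i : 0 <= q`_i.
  rewrite /q mulrBl coefB coefZ coefXn coefB coefCM coefXM.
  case: i => [|i] /=; first by rewrite mulr1 subr0 subrr.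
  by rewrite mulr0 sub0r opprB subr_ge0.
have dist_gt0 : 0 < `|r - z| by rewrite normr_gt0 subr_eq0 eq_sym.
have factor_p : (r * p`_0) *: 'X^0 - q = (r%:P - 'X) * p.
  by rewrite /q opprB addrC subrK.
have t_le : (r - `|z|) * p`_0 <= ((r * p`_0) *: 'X^0 - q).[`|z|].
  rewrite factor_p !(hornerM, hornerD, hornerN, hornerX, hornerC).
  apply: ler_wpM2l; first by rewrite subr_ge0.
  by have := term_le_horner 0 p_ge0 (normr_ge0 z); rewrite expr0 mulr1.
have := norm_monomial_sub_bounds (mulr_ge0 r_ge0 (p_ge0 0%N)) q_ge0 t_le.
rewrite factor_p !(hornerM, hornerD, hornerN, hornerX, hornerC) normrM.
have -> : r * p`_0 * `|z| ^+ 0 *+ 2 - (r - `|z|) * p`_0 = (r + `|z|) * p`_0.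
  by ring.
rewrite !(ler_pdivrMr, ler_pdivlMr) // !(mulrAC _ _^-1).
by rewrite !(ler_pdivrMr, ler_pdivlMr) // [`|p.[z]| * _]mulrC.
Qed.

(** Away from the origin the leading term of [(X - R) * p] dominates.  The lower
    bound [t] at [|z|] is [(|z| - R) * p`_n * |z|^n], whose reflection
    [2 * p`_n * |z|^(n+1) - t] is [(R + |z|) * p`_n * |z|^n]. *)
Lemma bounds_above_coef_ratios (F : numFieldType) (n : nat) (p : {poly F})
    (R z : F) :
    0 < R -> (size p <= n.+1)%N -> 0 < p`_n -> (forall i, 0 <= p`_i) ->
    (forall i, (i < n)%N -> p`_i <= R * p`_i.+1) ->
    z != R -> R <= `|z| ->
  (`|z| - R) / `|z - R| <= `|p.[z]| / (p`_n * `|z| ^+ n)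
    <= (R + `|z|) / `|R - z|.
Proof.
move=> R_gt0 size_p pn_gt0 p_ge0 ratio_le z_neq z_ge.
pose q := p`_n *: 'X^(n.+1) - ('X - R%:P) * p.
have q_ge0 i : 0 <= q`_i.
  rewrite /q mulrBl coefB coefZ coefXn coefB coefCM coefXM opprB addrCA.
  case: i => [|i] /=; first by rewrite mulr0 subr0 addr0 mulr_ge0 // ltW.
  rewrite eqSS; case: ltngtP => [i_lt|i_gt|->].
  - by rewrite mulr0 sub0r subr_ge0 ratio_le.
  (* Beyond the degree both products and the monomial vanish. *)
  - have size_le := leq_trans size_p i_gt.
    rewrite (nth_default _ size_le) (nth_default _ (leqW size_le)).
    by rewrite !mulr0 subr0 addr0.
  (* At i = n the monomial cancels the leading coefficient of 'X * p. *)
  - by rewrite mulr1 subrr addr0 mulr_ge0 // ltW.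
have dist_gt0 : 0 < `|z - R| by rewrite normr_gt0 subr_eq0.
have z_gt0 : 0 < `|z| := lt_le_trans R_gt0 z_ge.
have lead_gt0 : 0 < p`_n * `|z| ^+ n by rewrite mulr_gt0 ?exprn_gt0.
have factor_p : p`_n *: 'X^(n.+1) - q = ('X - R%:P) * p.
  by rewrite /q opprB addrC subrK.
have t_le : (`|z| - R) * (p`_n * `|z| ^+ n) <= (p`_n *: 'X^(n.+1) - q).[`|z|].
  rewrite factor_p !(hornerM, hornerD, hornerN, hornerX, hornerC).
  apply: ler_wpM2l; first by rewrite subr_ge0.
  exact: term_le_horner.
have := norm_monomial_sub_bounds (ltW pn_gt0) q_ge0 t_le.
rewrite factor_p !(hornerM, hornerD, hornerN, hornerX, hornerC) normrM.
have -> : p`_n * `|z| ^+ n.+1 *+ 2 - (`|z| - R) * (p`_n * `|z| ^+ n)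
          = (R + `|z|) * (p`_n * `|z| ^+ n) by rewrite exprS; ring.
rewrite [`|R - z|]distrC.
rewrite !(ler_pdivrMr, ler_pdivlMr) // !(mulrAC _ _^-1).
by rewrite !(ler_pdivrMr, ler_pdivlMr) // [`|p.[z]| * _]mulrC.
Qed.

Theorem theorem5p4 (K : realType) (n : nat) (p : {poly K}) (r R : K)
    (hn : (1 <= n)%N)
    (size_p : size p = n.+1)
    (coef_gt0 : forall i : nat, (i <= n)%N -> 0 < p`_i)
    (coef_noninc : forall i : nat, (i < n)%N -> p`_i >= p`_i.+1)
    (r_min : is_min (coef_ratios p) r)
    (R_max : is_max (coef_ratios p) R)
    (z : K[i])
    (z_neq_r : z != r%:C)
    (z_neq_R : z != R%:C) :
  (`|z| <= r%:C ->
     (r%:C - `|z|) / `|r%:C - z| <= `|(complex_poly p).[z]| / (p`_0)%:C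
     /\ `|(complex_poly p).[z]| / (p`_0)%:C <= (r%:C + `|z|) / `|r%:C - z|)
  /\
  (`|z| >= R%:C ->
     (`|z| - R%:C) / `|z - R%:C|
       <= `|(complex_poly p).[z]| / ((p`_n)%:C * `|z| ^+ n)
     /\ `|(complex_poly p).[z]| / ((p`_n)%:C * `|z| ^+ n)
       <= (R%:C + `|z|) / `|R%:C - z|).
Proof.
have ratio_in i : (i < n)%N -> p`_i / p`_i.+1 \in coef_ratios p.
  move=> i_lt; apply/mapP; exists i => //.
  by rewrite mem_iota size_p.
have ratio_gt0 x : x \in coef_ratios p -> 0 < x.
  case/mapP => i; rewrite mem_iota size_p /= add0n => i_lt ->.
  by rewrite divr_gt0 ?coef_gt0 // ltnW.
have p_ge0 i : 0 <= p`_i.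
  have [i_le|i_gt] := leqP i n; first exact/ltW/coef_gt0.
  by rewrite nth_default // size_p.
have ratio_ge i : r * p`_i.+1 <= p`_i.
  have [i_lt|i_ge] := ltnP i n; last first.
    by rewrite (nth_default _ (n := i.+1)) ?mulr0 ?p_ge0 // size_p.
  by rewrite -ler_pdivlMr ?coef_gt0 //; apply: r_min.2; apply: ratio_in.
have ratio_le i : (i < n)%N -> p`_i <= R * p`_i.+1.
  move=> i_lt; rewrite -ler_pdivrMr ?coef_gt0 //.
  by apply: R_max.2; apply: ratio_in.
have coefC i : (complex_poly p)`_i = (p`_i)%:C by exact: coef_map.
have r_gt0 := ratio_gt0 _ r_min.1; have R_gt0 := ratio_gt0 _ R_max.1.
split=> z_cmp.
  apply/andP; rewrite -coefC; apply: bounds_below_coef_ratios => //.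
  - by rewrite lecR ltW.
  - by rewrite coefC ltcR coef_gt0.
  - by move=> i; rewrite coefC lecR.
  - by move=> i; rewrite !coefC -rmorphM lecR.
apply/andP; rewrite -coefC; apply: bounds_above_coef_ratios => //.
- by rewrite ltcR.
- by rewrite size_map_poly size_p.
- by rewrite coefC ltcR coef_gt0.
- by move=> i; rewrite coefC lecR.
- by move=> i i_lt; rewrite !coefC -rmorphM lecR ratio_le.
Qed.
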